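(* Let $\ell_1,\dots,\ell_T:\mathbb{R}^d\to\mathbb{R}$ be convex functions and $g_t\in\partial\ell_t(w_t)$ for all $t$, where $w_t$ are the iterates defined below. Let $0<h_1\le\dots\le h_T$ be a sequence of hints such that $h_t\ge\|g_t\|$, where $h_t$ is provided at the start of round $t$, and put $h_{T+1}=h_T$. Let $\epsilon>0$, $k\ge3$, $V_t=4h_t^2+\sum_{s=1}^{t-1}\|g_s\|^2$, $$B_t=4\sum_{s=1}^t\left(4+\sum_{s'=1}^{s-1}\frac{\|g_{s'}\|^2}{h_{s'}^2}\right),\qquad\alpha_t=\frac{\epsilon}{\sqrt{B_t}\log^2(B_t)},$$ and $$\psi_t(w)=k\int_0^{\|w\|}\min_{0<\eta\le\frac1{h_t}}\left[\frac{\log(x/\alpha_t+1)}{\eta}+\eta V_t\right]dx .$$ Then for all $u\in\mathbb{R}^d$, Centered Mirror Descent (see context) with regularizers $\psi_t$ and $\varphi_t\equiv0$ guarantees $$\sum_{t=1}^T\big(\ell_t(w_t)-\ell_t(u)\big)\le4\epsilon h_T+2k\|u\|\max\left\{\sqrt{V_{T+1}\,\lambda},\ h_T\,\lambda\right\},\qquad \lambda=\log\left(\frac{\|u\|\sqrt{B_{T+1}}\log^2(B_{T+1})}{\epsilon}+1\right).$$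
   Context: $\|\cdot\|$ is the Euclidean norm, $\log$ the natural logarithm. For differentiable $\psi$, $D_\psi(x|y)=\psi(x)-\psi(y)-\langle\nabla\psi(y),x-y\rangle$. The minimum over $\eta$ in the integrand is an infimum (equal to $0$) at $x=0$. Centered Mirror Descent with regularizers $\psi_1,\psi_2,\dots$ and composite penalties $\varphi_t$: $w_1=\arg\min_w\psi_1(w)$ (here $w_1=0$). In round $t$, play $w_t$, observe $\ell_t$, choose $\psi_{t+1}$ and $\varphi_t$, set $\Delta_t(w)=D_{\psi_{t+1}}(w|w_1)-D_{\psi_t}(w|w_1)$ and $\phi_t=\Delta_t+\varphi_t$, and update $$w_{t+1}=\arg\min_{w\in\mathbb{R}^d}\ \ell_t(w)+D_{\psi_t}(w|w_t)+\phi_t(w).$$ *)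

(* Defs.v *)
(* MathComp-Analysis, over an arbitrary [R : realType]; vectors of R^d are row
   vectors ['rV[R]_d]. *)
From HB Require Import structures.
From mathcomp Require Import all_boot all_order all_algebra.
From mathcomp Require Import all_classical all_reals all_analysis.

Set Implicit Arguments.
Unset Strict Implicit.
Unset Printing Implicit Defensive.

Import Order.TTheory GRing.Theory Num.Theory.
Import numFieldNormedType.Exports.

Local Open Scope classical_set_scope.
Local Open Scope ring_scope.

Definition dotp (R : realType) (d : nat) (u v : 'rV[R]_d) : R :=
  \sum_(i < d) u 0 i * v 0 i.

(* The norm [`|u|] of the library on ['rV[R]_d] is the sup norm, hence this
   separate Euclidean norm. *)
Definition enorm (R : realType) (d : nat) (u : 'rV[R]_d) : R :=
  Num.sqrt (dotp u u).

Definition gradient (R : realType) (d : nat) (f : 'rV[R]_d -> R)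
    (y : 'rV[R]_d) : 'rV[R]_d :=
  \row_(i < d) 'D_(delta_mx 0 i) f y.

(* Meaningful when [psi] is differentiable at [y]; ['D_v f y] is a total
   operator. *)
Definition bregman (R : realType) (d : nat) (psi : 'rV[R]_d -> R)
    (x y : 'rV[R]_d) : R :=
  psi x - psi y - dotp (gradient psi y) (x - y).

Definition subdifferential (R : realType) (d : nat) (f : 'rV[R]_d -> R)
    (x : 'rV[R]_d) : set 'rV[R]_d :=
  [set g | forall y, f x + dotp g (y - x) <= f y].

Definition argmin (R : realType) (X : Type) (f : X -> R) : set X :=
  [set x | forall y, f x <= f y].

(* All sequences below are indexed from 1; their values at index 0 are never
   used. *)

Definition centered_mirror_descent (R : realType) (d T : nat)
    (ell psi varphi : nat -> 'rV[R]_d -> R) (w : nat -> 'rV[R]_d) : Prop :=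
  let Delta t v := bregman (psi t.+1) v (w 1%N) - bregman (psi t) v (w 1%N) in
  let phi t v := Delta t v + varphi t v in
  argmin (psi 1%N) (w 1%N) /\
  forall t, (1 <= t <= T)%N ->
    argmin (fun v => ell t v + bregman (psi t) v (w t) + phi t v) (w t.+1).

Definition V_ (R : realType) (d : nat) (h : nat -> R) (g : nat -> 'rV[R]_d)
    (t : nat) : R :=
  4 * h t ^+ 2 + \sum_(1 <= s < t) enorm (g s) ^+ 2.

Definition B_ (R : realType) (d : nat) (h : nat -> R) (g : nat -> 'rV[R]_d)
    (t : nat) : R :=
  4 * \sum_(1 <= s < t.+1)
        (4 + \sum_(1 <= s' < s) enorm (g s') ^+ 2 / h s' ^+ 2).

Definition alpha_ (R : realType) (d : nat) (eps : R) (h : nat -> R)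
    (g : nat -> 'rV[R]_d) (t : nat) : R :=
  eps / (Num.sqrt (B_ h g t) * ln (B_ h g t) ^+ 2).

(* [inf] rather than a minimum: at x = 0 the infimum is 0 and is not attained. *)
Definition psi_ (R : realType) (d : nat) (k eps : R) (h : nat -> R)
    (g : nat -> 'rV[R]_d) (t : nat) (w : 'rV[R]_d) : R :=
  k * \int[lebesgue_measure]_(x in `[0, enorm w])
        inf [set ln (x / alpha_ eps h g t + 1) / eta + eta * V_ h g t
            | eta in [set eta : R | 0 < eta <= 1 / h t]].

(* Main.v *)
Require Import Defs.
From HB Require Import structures.
From mathcomp Require Import all_boot all_order all_algebra.
From mathcomp Require Import all_classical all_reals all_analysis.
From mathcomp Require Import ring lra.

Set Implicit Arguments.
Unset Strict Implicit.
Unset Printing Implicit Defensive.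

Import Order.TTheory GRing.Theory Num.Theory.
Import numFieldNormedType.Exports.

Local Open Scope classical_set_scope.
Local Open Scope ring_scope.

(* Since [D_psi_t(v|0) = psi_t v], the objective of round [t] is, up to a
   constant, [ell_t v + psi_(t+1) v - <theta_t, v>] with
   [theta_t = grad psi_t (w_t)].  First-order optimality and summation by parts
   bound the regret by [psi_(T+1) u] plus the sum of the stability terms
     [<g_t, w_t - w_(t+1)> - D_psi_t(w_(t+1)|w_t) - (psi_(t+1) - psi_t)(w_(t+1))].

   Write [L x = ln (x / alpha_t + 1)], let [eta x = min (sqrt (L x / V_t)) (1 / h_t)]
   be the optimal step in the integrand, [M = max |w_t| |w_(t+1)|] and
   [r = |w_(t+1) - w_t|].  On [[0, M]] the slope of [psi_t'] is at least
   [k K] with [1 / K = (M + alpha_t) eta M], so the Bregman divergence is at least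
   [3 K r^2 / 2].
   - If [L M >= 3], the increase of [V_t] makes [psi_(t+1) - psi_t] at least
     [|g_t|^2 (2 / (3 K) - r / h_t)] at [w_(t+1)], and completing the square shows
     that the stability term is nonpositive.
   - If [L M < 3], then [M + alpha_t <= e^3 alpha_t], and the stability term is at
     most [|g_t|^2 / (6 K) <= 9 alpha_t |g_t|^2 / (2 h_t)].
   With [c_t = |g_t|^2 / h_t^2] and [S_t = 4 + sum_(s < t) c_s] one has
   [B_t >= S_t^2], so the sum of [c_t / (sqrt B_t ln^2 B_t)] is dominated by a
   telescoping sum of differences of [1 / ln S_t]. *)

(** * Euclidean geometry and radial functions *)

Section euclidean.
Context (R : realType) (d : nat).
Implicit Types u v w : 'rV[R]_d.

Lemma dotpC u v : dotp u v = dotp v u.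
Proof. by apply: eq_bigr => i _; rewrite mulrC. Qed.

Lemma dotpDl u v w : dotp (u + v) w = dotp u w + dotp v w.
Proof. by rewrite -big_split; apply: eq_bigr => i _; rewrite mxE mulrDl. Qed.

Lemma dotpZl a u v : dotp (a *: u) v = a * dotp u v.
Proof. by rewrite mulr_sumr; apply: eq_bigr => i _; rewrite mxE mulrA. Qed.

Lemma dotpDr u v w : dotp u (v + w) = dotp u v + dotp u w.
Proof. by rewrite dotpC dotpDl !(dotpC _ u). Qed.

Lemma dotpZr a u v : dotp u (a *: v) = a * dotp u v.
Proof. by rewrite dotpC dotpZl dotpC. Qed.

Lemma dotpBl u v w : dotp (u - v) w = dotp u w - dotp v w.
Proof. by rewrite dotpDl -scaleN1r dotpZl mulN1r. Qed.

Lemma dotpBr u v w : dotp u (v - w) = dotp u v - dotp u w.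
Proof. by rewrite dotpC dotpBl !(dotpC _ u). Qed.

Lemma dotp0l u : dotp 0 u = 0.
Proof. by rewrite -(scale0r u) dotpZl mul0r. Qed.

Lemma dotp_ge0 u : 0 <= dotp u u.
Proof. by apply: sumr_ge0 => i _; rewrite -expr2 sqr_ge0. Qed.

Lemma dotp_delta u i : dotp u (delta_mx 0 i) = u 0 i.
Proof.
rewrite /dotp (bigD1 i)//= big1 ?addr0 => [|j ji]; rewrite mxE eqxx.
  by rewrite eqxx mulr1.
by rewrite (negbTE ji) mulr0.
Qed.

Lemma enorm_ge0 u : 0 <= enorm u.
Proof. exact: sqrtr_ge0. Qed.

Lemma sqr_enorm u : enorm u ^+ 2 = dotp u u.
Proof. by rewrite sqr_sqrtr// dotp_ge0. Qed.

Lemma enorm0 : enorm (0 : 'rV[R]_d) = 0.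
Proof. by rewrite /enorm dotp0l sqrtr0. Qed.

Lemma enorm_eq0 u : enorm u = 0 -> u = 0.
Proof.
move=> u0; have : dotp u u == 0 by rewrite -sqr_enorm u0 expr0n.
rewrite psumr_eq0 => [/allP uu|i _]; last by rewrite -expr2 sqr_ge0.
apply/rowP => i; rewrite mxE; apply/eqP.
by have := uu i (mem_index_enum i); rewrite mulf_eq0 orbb.
Qed.

Lemma cauchy_schwarz u v : dotp u v <= enorm u * enorm v.
Proof.
have [u0|u0] := eqVneq (enorm u) 0.
  by rewrite u0 (enorm_eq0 u0) dotp0l mul0r.
have [v0|v0] := eqVneq (enorm v) 0.
  by rewrite v0 (enorm_eq0 v0) dotpC dotp0l mulr0.
have uv0 : 0 < enorm u * enorm v.
  by rewrite mulr_gt0// lt_neqAle enorm_ge0 eq_sym ?u0 ?v0.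
have := dotp_ge0 (enorm v *: u - enorm u *: v).
rewrite !(dotpBl, dotpBr, dotpZl, dotpZr) -!sqr_enorm (dotpC v u) => H.
rewrite -(ler_pM2l uv0) -subr_ge0.
by move: H; set a := enorm u; set b := enorm v; nra.
Qed.

Lemma normr_dotp u v : `|dotp u v| <= enorm u * enorm v.
Proof.
rewrite ler_norml cauchy_schwarz andbT lerNl.
have := cauchy_schwarz (-1 *: u) v; rewrite dotpZl mulN1r.
by rewrite {1}/enorm dotpZl dotpZr !mulN1r opprK.
Qed.

Lemma sqr_enormB u v :
  enorm (u - v) ^+ 2 = enorm u ^+ 2 + enorm v ^+ 2 - 2 * dotp u v.
Proof. by rewrite !sqr_enorm !(dotpBl, dotpBr) (dotpC v u); ring. Qed.

Lemma enorm_distl u v : enorm u <= enorm v + enorm (u - v).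
Proof.
rewrite -ler_sqr ?nnegrE ?addr_ge0 ?enorm_ge0//.
have := cauchy_schwarz v (u - v).
rewrite sqrrD -mulr_natl sqr_enormB dotpBr -sqr_enorm (dotpC v u).
by move: (dotp u v) => z; nra.
Qed.

Lemma enormBC u v : enorm (u - v) = enorm (v - u).
Proof. by rewrite /enorm -(opprB v u) -scaleN1r dotpZl dotpZr !mulN1r opprK. Qed.

End euclidean.

Lemma le_of_derive_ge0 (R : realType) (f df : R -> R) (a b : R) : a <= b ->
  (forall x : R, a <= x <= b -> is_derive x 1 f (df x)) ->
  (forall x, a <= x <= b -> 0 <= df x) -> f a <= f b.
Proof.
move=> ab fd df0.
have [c cab E] : exists2 c, c \in `[a, b]%R & f b - f a = df c * (b - a).
  apply: MVT_segment => //.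
    by move=> x; rewrite in_itv/= => /andP[ax xb]; apply: fd; rewrite !ltW.
  apply: derivable_within_continuous => x; rewrite in_itv/= => xab.
  exact: (ex_derive (is_derive := fd _ xab)).
by rewrite -subr_ge0 E mulr_ge0 ?subr_ge0// df0//; move: cab; rewrite in_itv.
Qed.

(** * Convexity, continuity and gradient of functions of the Euclidean norm *)

Section radial.
Context (R : realType) (F p : R -> R).
Hypothesis dF : forall x : R, 0 <= x -> is_derive x 1 F (p x).
Hypothesis F0 : F 0 = 0.
Hypothesis p0 : p 0 = 0.
Hypothesis cp : forall x : R, 0 <= x -> {for x, continuous p}.

(** Stated with increments rather than as [p' >= kap], because the density to which it is applied
    behaves like a square root at 0 and has infinite right slope there. *)
Definition slope_ge (kap M : R) :=
  forall s t : R, 0 <= s -> s <= t -> t <= M -> kap * (t - s) <= p t - p s.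

(** Subtracting the quadratic from [F] leaves a function whose derivative, by [slope_ge], is
    nonpositive before [a] and nonnegative after, so that its minimum is at [a]. *)
Lemma quadratic_lower_bound kap M a b : slope_ge kap M ->
  0 <= a <= M -> 0 <= b <= M ->
  F a + p a * (b - a) + kap / 2 * (b - a) ^+ 2 <= F b.
Proof.
move=> pM /andP[a0 aM] /andP[b0 bM].
pose f := fun x : R => F x - (p a * (x - a) + kap / 2 * (x - a) ^+ 2).
pose df := fun x : R => p x - (p a + kap * (x - a)).
have fdf (x : R) : 0 <= x -> is_derive x 1 f (df x).
  move=> x0; have := dF x0 => ?; rewrite /f.
  by apply: is_derive_eq; rewrite /df /GRing.scale/=; field.
have fa : f a = F a by rewrite /f subrr expr0n !mulr0 addr0 subr0.
suff : f a <= f b by rewrite fa /f; lra.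
have [ab|/ltW ba] := leP a b.
  apply: (@le_of_derive_ge0 _ f df) => // z /andP[az zb].
    by apply: fdf; exact: le_trans az.
  have := pM a z a0 az (le_trans zb bM); rewrite /df; lra.
rewrite -lerN2.
apply: (@le_of_derive_ge0 _ (fun z => - f z) (fun z => - df z)) => //
  z /andP[bz za].
  by apply: is_deriveN; apply: fdf; exact: le_trans bz.
have := pM z a (le_trans b0 bz) za aM; rewrite /df; lra.
Qed.

Context (d : nat).
Implicit Types x y v : 'rV[R]_d.

(* The gradient of [F \o enorm]; it is [0] at [0] since [p 0 = 0]. *)
Definition rgrad x : 'rV[R]_d := (p (enorm x) / enorm x) *: x.

Lemma dotp_rgrad_self x : dotp (rgrad x) x = p (enorm x) * enorm x.
Proof.
rewrite dotpZl -sqr_enorm; have [->|x0] := eqVneq (enorm x) 0.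
  by rewrite expr0n/= !mulr0.
by rewrite expr2 mulrA divfK.
Qed.

(** The one-dimensional bound for the norms misses an angular term: with [q = p |x| / |x|], it is
    [q (|x| |y| - <x, y>)] on the right, and the same with [kap] for [q] on the left. The slope
    condition from 0 gives [q >= kap], and Cauchy-Schwarz gives the sign. *)
Lemma radial_strong_convexity kap M x y : 0 <= kap -> slope_ge kap M ->
  enorm x <= M -> enorm y <= M ->
  kap / 2 * enorm (y - x) ^+ 2 <=
  F (enorm y) - F (enorm x) - dotp (rgrad x) (y - x).
Proof.
move=> kap0 pM xM yM.
have := quadratic_lower_bound pM (a := enorm x) (b := enorm y).
rewrite !enorm_ge0 xM yM => /(_ isT isT).
rewrite dotpBr dotp_rgrad_self sqr_enormB dotpZl (dotpC y x).
have := cauchy_schwarz x y; have [x0|x0] := eqVneq (enorm x) 0.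
  by rewrite (enorm_eq0 x0) enorm0 p0 F0 dotp0l; lra.
have xgt0 : 0 < enorm x by rewrite lt_neqAle enorm_ge0 eq_sym x0.
have : kap <= p (enorm x) / enorm x.
  rewrite ler_pdivlMr//.
  by have := pM 0 _ (lexx 0) (enorm_ge0 x) xM; rewrite p0; lra.
set q := _ / _ => kq.
have -> : p (enorm x) = q * enorm x by rewrite /q divfK.
move: (enorm x) (enorm y) (dotp x y) (enorm_ge0 y) => a b z b0 zab H.
have : 0 <= (q - kap) * (a * b - z) by rewrite mulr_ge0 ?subr_ge0.
by nra.
Qed.

Hypothesis p_incr : forall M, slope_ge 0 M.

Lemma radial_convexity x y :
  F (enorm x) + dotp (rgrad x) (y - x) <= F (enorm y).
Proof.
have xM : enorm x <= Num.max (enorm x) (enorm y) by rewrite le_max lexx.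
have yM : enorm y <= Num.max (enorm x) (enorm y) by rewrite le_max lexx orbT.
have := radial_strong_convexity (lexx 0) (@p_incr _) xM yM.
by rewrite !mul0r; lra.
Qed.

Lemma p_ge0 r : 0 <= r -> 0 <= p r.
Proof.
by move=> r0; have := p_incr (lexx 0) r0 (lexx r); rewrite mul0r p0 subr0.
Qed.

(** Convexity at [x], compared with the point 0 where [F] vanishes. *)
Lemma radial_le x : F (enorm x) <= enorm x * p (enorm x).
Proof.
have := radial_convexity x 0; rewrite enorm0 F0 dotpBr dotp_rgrad_self.
by rewrite dotpC dotp0l; lra.
Qed.

Lemma continuous_enorm_line x v :
  {for 0, continuous (fun s : R => enorm (s *: v + x))}.
Proof.
rewrite (_ : (fun s => _) = Num.sqrt \o
    (fun s => s ^+ 2 * dotp v v + s * (2 * dotp v x) + dotp x x)); last first.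
  apply/funext => s /=; congr Num.sqrt.
  by rewrite !(dotpDl, dotpDr, dotpZl, dotpZr) (dotpC x v); ring.
apply: continuous_comp; last exact: sqrt_continuous.
apply: cvgD; last exact: cvg_cst.
apply: cvgD; apply: cvgM; try exact: cvg_cst; last exact: cvg_id.
exact: exprn_continuous.
Qed.

Lemma normr_dotp_rgrad x v : `|dotp (rgrad x) v| <= p (enorm x) * enorm v.
Proof.
have [x0|x0] := eqVneq (enorm x) 0.
  by rewrite x0 p0 mul0r (enorm_eq0 x0) /rgrad scaler0 dotp0l normr0.
have px : 0 <= p (enorm x) / enorm x.
  by rewrite divr_ge0 ?enorm_ge0// p_ge0// enorm_ge0.
rewrite dotpZl normrM (ger0_norm px).
apply: le_trans (ler_wpM2l px (normr_dotp x v)) _.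
by rewrite mulrA divfK.
Qed.

(** Away from 0 this is a quotient of continuous functions. At [x = 0] the direction of [rgrad] may
    jump, but its length tends to [p 0 = 0], so a squeeze applies. *)
Lemma continuous_rgrad_line x v :
  {for 0, continuous (fun s : R => dotp (rgrad (s *: v + x)) v)}.
Proof.
have cn := @continuous_enorm_line x v.
have cpn : {for 0, continuous (fun s : R => p (enorm (s *: v + x)))}.
  by apply: continuous_comp => //; apply: cp; exact: enorm_ge0.
have [x0|x0] := eqVneq (enorm x) 0.
  rewrite /prop_for /continuous_at scale0r add0r.
  have -> : dotp (rgrad x) v = 0.
    by rewrite (enorm_eq0 x0) /rgrad scaler0 dotp0l.
  have pn0 : p (enorm (s *: v + x)) * enorm v @[s --> (0 : R)] --> 0.
    rewrite -[X in _ --> X](mul0r (enorm v)); apply: cvgM; last exact: cvg_cst.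
    have E : p (enorm (0 *: v + x)) = 0 by rewrite scale0r add0r x0.
    by move: cpn; rewrite /prop_for /continuous_at E.
  apply: (@squeeze_cvgr _ _ _ _
    (fun s => - (p (enorm (s *: v + x)) * enorm v)) _ _ _ 0 _ pn0).
    by apply: nearW => s; rewrite -ler_norml normr_dotp_rgrad.
  by rewrite -[X in _ --> X]oppr0; exact: cvgN.
rewrite (_ : (fun s => _) = fun s => p (enorm (s *: v + x)) /
   enorm (s *: v + x) * (s * dotp v v + dotp x v)); last first.
  by apply/funext => s; rewrite dotpZl dotpDl dotpZl.
apply: cvgM; last first.
  by apply: cvgD; [apply: cvgM; [exact: cvg_id|exact: cvg_cst]|exact: cvg_cst].
apply: cvgM => //; apply: cvgV => //.
by rewrite scale0r add0r.
Qed.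

(* The difference quotient along [v] lies between [<grad x, v>] and
   [<grad (x + s v), v>] by convexity. *)
Lemma is_derive_radial x v :
  is_derive x v (fun y => F (enorm y)) (dotp (rgrad x) v).
Proof.
pose f := fun y : 'rV[R]_d => F (enorm y).
suff H : (s^-1 *: ((f \o shift x) (s *: v) - f x) @[s --> (0:R)^'] -->
    dotp (rgrad x) v).
  split; [by apply/cvg_ex; exists (dotp (rgrad x) v)|].
  by apply/cvg_lim => //; exact: Rhausdorff.
pose G := fun s : R => dotp (rgrad (s *: v + x)) v.
have G0 : G 0 = dotp (rgrad x) v by rewrite /G scale0r add0r.
have cG : G s @[s --> (0 : R)^'] --> dotp (rgrad x) v.
  by rewrite -G0; apply/continuous_withinNx; exact: continuous_rgrad_line.
have cD : `|G s - dotp (rgrad x) v| @[s --> (0 : R)^'] --> 0.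
  have := cvg_norm (cvgB cG (cvg_cst (dotp (rgrad x) v))).
  by rewrite subrr normr0; apply.
apply: (@squeeze_cvgr _ _ _ _
   (fun s => dotp (rgrad x) v - `|G s - dotp (rgrad x) v|)
   (fun s => dotp (rgrad x) v + `|G s - dotp (rgrad x) v|)).
- near=> s; rewrite -ler_distl.
  have s0 : s != 0 by near: s; exact: nbhs_dnbhs_neq.
  rewrite /= /GRing.scale/= -/(f (s *: v + x)).
  have := radial_convexity x (s *: v + x).
  have := radial_convexity (s *: v + x) x.
  rewrite addrK opprD addrCA subrr addr0 -scaleNr !dotpZr -/(G s) -/(f _) -/(f x).
  set g0 := dotp _ _; set b := f _; set a := f x => H1 H2.
  have : b - a = s * (s^-1 * (b - a)) by rewrite mulrA divff// mul1r.
  set q := s^-1 * _ => E.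
  have g0q : s * g0 <= s * q by rewrite -E; lra.
  have qG : s * q <= s * G s by rewrite -E; lra.
  have [sn|sp] : s < 0 \/ 0 < s by apply/orP; rewrite -neq_lt.
    move: g0q qG; rewrite !ler_nM2l// => g0q qG.
    rewrite ler0_norm ?subr_le0// ler0_norm ?subr_le0//; last first.
      exact: le_trans g0q.
    by rewrite lerN2 lerB.
  move: g0q qG; rewrite !ler_pM2l// => g0q qG.
  rewrite ger0_norm ?subr_ge0// ger0_norm ?subr_ge0//; last first.
    exact: le_trans qG.
  by rewrite lerB.
- by have := cvgB (cvg_cst (dotp (rgrad x) v)) cD; rewrite subr0; apply.
- by have := cvgD (cvg_cst (dotp (rgrad x) v)) cD; rewrite addr0; apply.
Unshelve. all: by end_near. Qed.

Lemma gradient_radial x : gradient (fun y => F (enorm y)) x = rgrad x.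
Proof.
apply/rowP => i; rewrite mxE -dotp_delta.
exact: (derive_val (is_derive := is_derive_radial x (delta_mx 0 i))).
Qed.

End radial.

(** * The integrand of the regularizer *)

Section rate.
Context (R : realType).
Implicit Types V h l eta : R.

(** The unconstrained minimizer of [l / eta + eta * V], capped at [1 / h]. At [l = 0] it is 0,
    outside the admissible range. *)
Definition opt_eta V h l := Num.min (Num.sqrt l / Num.sqrt V) h^-1.

(* Closed form of [inf_(0 < eta <= 1 / h) (l / eta + eta * V)]; unlike the
   value at [opt_eta], it is visibly continuous at [l = 0]. *)
Definition rate V h l := 2 * Num.sqrt V * Num.sqrt l +
  h * Num.max (Num.sqrt l - Num.sqrt V / h) 0 ^+ 2.

Lemma opt_eta_ge0 V h l : 0 < h -> 0 <= opt_eta V h l.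
Proof.
move=> h0; rewrite le_min invr_ge0 (ltW h0) andbT.
by rewrite divr_ge0 ?sqrtr_ge0.
Qed.

Lemma opt_eta_gt0 V h l : 0 < V -> 0 < h -> 0 < l -> 0 < opt_eta V h l.
Proof. by move=> V0 h0 l0; rewrite lt_min invr_gt0 h0 divr_gt0 ?sqrtr_gt0. Qed.

Lemma opt_eta_le V h l : opt_eta V h l <= h^-1.
Proof. by rewrite ge_min lexx orbT. Qed.

Lemma rate_ge0 V h l : 0 < h -> 0 <= rate V h l.
Proof.
move=> h0; apply: addr_ge0; first by rewrite !mulr_ge0 ?sqrtr_ge0.
by rewrite mulr_ge0 ?sqr_ge0// ltW.
Qed.

Lemma rate0 V h : 0 < V -> 0 < h -> rate V h 0 = 0.
Proof.
move=> V0 h0; rewrite /rate sqrtr0 mulr0 sub0r max_r ?expr0n ?mulr0 ?addr0//.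
by rewrite oppr_le0 divr_ge0 ?sqrtr_ge0// ltW.
Qed.

(** Completing the square turns the cost into [2 c q + (q - eta c)^2 / eta], with [c] and [q] the
    roots of [V] and [l]. If [q > c / h], the last term is smallest at the cap [eta = 1 / h];
    otherwise 0 is a sufficient lower bound for it. *)
Lemma rate_le V h l eta : 0 < V -> 0 < h -> 0 <= l -> 0 < eta <= h^-1 ->
  rate V h l <= l / eta + eta * V.
Proof.
move=> V0 h0 l0 /andP[e0 eh]; rewrite /rate.
have Vs : Num.sqrt V ^+ 2 = V by rewrite sqr_sqrtr// ltW.
have ls : Num.sqrt l ^+ 2 = l by rewrite sqr_sqrtr.
rewrite -{3}Vs -{3}ls.
move: (sqrtr_ge0 V) (sqrtr_ge0 l); set c := Num.sqrt V; set q := Num.sqrt l.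
move=> c0 q0.
have -> : q ^+ 2 / eta + eta * c ^+ 2 =
    2 * c * q + (q - eta * c) ^+ 2 / eta by field; rewrite gt_eqF.
rewrite lerD2l; have [H|H] := leP (q - c / h) 0.
  by rewrite expr0n/= mulr0 divr_ge0 ?sqr_ge0// ltW.
have ech : eta * c <= c / h by rewrite mulrC ler_wpM2l.
have he : h <= eta^-1 by rewrite -(invrK h) lef_pV2 ?posrE ?invr_gt0.
rewrite mulrC ler_pM ?sqr_ge0 ?(ltW h0)//.
rewrite ler_sqr ?nnegrE; [by rewrite lerB|exact: ltW|].
by rewrite subr_ge0 (le_trans ech)// -subr_ge0 ltW.
Qed.

Lemma rate_opt V h l : 0 < V -> 0 < h -> 0 < l ->
  rate V h l = l / opt_eta V h l + opt_eta V h l * V.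
Proof.
move=> V0 h0 l0; rewrite /rate /opt_eta.
have Vs : Num.sqrt V ^+ 2 = V by rewrite sqr_sqrtr// ltW.
have ls : Num.sqrt l ^+ 2 = l by rewrite sqr_sqrtr// ltW.
rewrite -{5}Vs -{3}ls.
have : 0 < Num.sqrt V by rewrite sqrtr_gt0.
have : 0 < Num.sqrt l by rewrite sqrtr_gt0.
set c := Num.sqrt V; set q := Num.sqrt l => q0 c0.
have [H|H] := leP (q / c) h^-1.
  rewrite max_r; last first.
    by rewrite subr_le0; move: H; rewrite ler_pdivrMr// mulrC.
  rewrite expr0n/= mulr0 addr0; field; by rewrite !gt_eqF.
rewrite max_l; last first.
  by rewrite subr_ge0; move: H; rewrite ltr_pdivlMr// mulrC => /ltW.
field; by rewrite gt_eqF.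
Qed.

Lemma rate_inf V h l : 0 < V -> 0 < h -> 0 <= l ->
  inf [set l / eta + eta * V | eta in [set eta : R | 0 < eta <= 1 / h]] =
  rate V h l.
Proof.
move=> V0 h0 l0; rewrite div1r; set E := [set _ | _ in _].
have lbE : lbound E (rate V h l) by move=> _ [eta eh <-]; exact: rate_le.
have E0 : E !=set0.
  by exists (l / h^-1 + h^-1 * V), h^-1; rewrite //= invr_gt0 h0 lexx.
apply/eqP; rewrite eq_le lb_le_inf// andbT.
have [l0'|] := ltP 0 l.
  rewrite rate_opt//; apply: ge_inf; first by exists (rate V h l).
  by exists (opt_eta V h l); rewrite //= opt_eta_gt0//= opt_eta_le.
move=> l0'; have {l0 l0'} l00 : l = 0 by apply/eqP; rewrite eq_le l0 l0'.
(* At [l = 0] no step is optimal, but the cost [eta * V] can be made as small as wanted: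
   [min (e / V) (1 / h)] brings it to at most [e]. *)
rewrite l00 rate0//; apply/ler_addgt0Pl => e e0; rewrite addr0.
have m0 : 0 < Num.min (e / V) h^-1 by rewrite lt_min divr_gt0// invr_gt0.
apply: (@le_trans _ _ (Num.min (e / V) h^-1 * V)); last first.
  by rewrite -ler_pdivlMr// ge_min lexx.
apply: ge_inf; first by exists (rate V h l).
exists (Num.min (e / V) h^-1); last by rewrite l00 mul0r add0r.
by rewrite /= m0 ge_min lexx orbT.
Qed.

(* By optimality of [opt_eta] for [l'], used as a suboptimal choice for [l]. *)
Lemma rate_slope V h l l' : 0 < V -> 0 < h -> 0 <= l -> 0 < l' ->
  (l' - l) / opt_eta V h l' <= rate V h l' - rate V h l.
Proof.
move=> V0 h0 l0 l'0; rewrite (rate_opt V0 h0 l'0).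
have /(rate_le V0 h0 l0) : 0 < opt_eta V h l' <= h^-1.
  by rewrite opt_eta_gt0// opt_eta_le.
rewrite mulrBl; lra.
Qed.

(** Let [e] be optimal for the new parameters and [o] for the old ones; [e] is admissible for both.
    If [e >= o / 3], the extra cost [e * G] suffices. Otherwise [e] is so far from [o] that the old
    cost at [e] exceeds its minimum by at least [4 / 3 * V * o], which is enough since
    [4 * G <= V]. *)
Lemma rate_gain V h V' h' G l l' : 0 < V -> 0 < h -> h <= h' -> 0 <= G ->
  4 * G <= V -> V + G <= V' -> 0 <= l -> l <= l' ->
  rate V h l + G * opt_eta V h l / 3 <= rate V' h' l'.
Proof.
move=> V0 h0 hh' G0 GV VV' l0 ll'.
have h'0 : 0 < h' by exact: lt_le_trans hh'.
have V'0 : 0 < V' by lra.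
have [l00|lgt0] := leP l 0.
  have -> : l = 0 by apply/eqP; rewrite eq_le l0 l00.
  rewrite rate0// /opt_eta sqrtr0 mul0r min_l ?invr_ge0 ?(ltW h0)//.
  by rewrite mulr0 mul0r addr0 rate_ge0.
have l'0 : 0 < l' by exact: lt_le_trans ll'.
rewrite (rate_opt V'0 h'0 l'0).
have : opt_eta V' h' l' <= h^-1.
  by rewrite (le_trans (opt_eta_le _ _ _))// lef_pV2 ?posrE.
have := opt_eta_gt0 V'0 h'0 l'0; set e := opt_eta V' h' l' => e0 eh.
have H1 : l / e + e * V + e * G <= l' / e + e * V'.
  by rewrite -addrA -mulrDr lerD ?ler_wpM2l ?ler_wpM2r ?invr_ge0 ?(ltW e0).
apply: le_trans H1.
have := rate_le V0 h0 l0 (_ : 0 < e <= h^-1); rewrite e0 eh => /(_ isT) H2.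
have Vo : opt_eta V h l ^+ 2 * V <= l.
  have o1 : opt_eta V h l <= Num.sqrt l / Num.sqrt V by rewrite ge_min lexx.
  rewrite -ler_pdivlMr// -[X in X / V](sqr_sqrtr l0).
  rewrite -[X in _ / X](sqr_sqrtr (ltW V0)) -expr_div_n ler_sqr ?nnegrE//.
  by rewrite opt_eta_ge0.
have := opt_eta_gt0 V0 h0 lgt0; have := rate_opt V0 h0 lgt0.
set o := opt_eta V h l in Vo * => ro o0.
have [oe|eo] := leP (o / 3) e.
  have : G * (o / 3) <= G * e by rewrite ler_wpM2l.
  lra.
have eo3 : 3 * e <= o by lra.
have loe : 3 * V <= l / (e * o).
  rewrite ler_pdivlMr ?mulr_gt0//; apply: le_trans Vo.
  have -> : 3 * V * (e * o) = 3 * e * (o * V) by ring.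
  by rewrite expr2 -[leRHS]mulrA ler_wpM2r ?mulr_ge0 ?(ltW o0) ?(ltW V0).
have -> : l / e + e * V = rate V h l + (o - e) * (l / (e * o) - V).
  by rewrite ro; field; rewrite !gt_eqF.
have : o * (2 / 3) * (2 * V) <= (o - e) * (l / (e * o) - V).
  by rewrite ler_pM ?mulr_ge0 ?(ltW o0) ?(ltW V0)//; lra.
have : G * o <= V * o by rewrite ler_wpM2r ?(ltW o0)//; lra.
have : 0 <= V * o by rewrite mulr_ge0 ?(ltW o0) ?(ltW V0).
have : 0 <= e * G by rewrite mulr_ge0 ?(ltW e0).
move: ((o - e) * (l / (e * o) - V)) => W; lra.
Qed.

Lemma rate_le_max V h l : 0 < V -> 0 < h -> 0 <= l ->
  rate V h l <= 2 * Num.max (Num.sqrt (V * l)) (h * l).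
Proof.
move=> V0 h0 l0; rewrite sqrtrM ?(ltW V0)// /rate.
have Vs : Num.sqrt V ^+ 2 = V by rewrite sqr_sqrtr// ltW.
have ls : Num.sqrt l ^+ 2 = l by rewrite sqr_sqrtr.
rewrite -{4}ls.
move: (sqrtr_ge0 V) (sqrtr_ge0 l); set c := Num.sqrt V; set q := Num.sqrt l.
move=> c0 q0.
have [H|H] := leP (q - c / h) 0.
  by rewrite expr0n/= mulr0 addr0 -mulrA ler_wpM2l// le_max lexx.
apply: (@le_trans _ _ (2 * (h * q ^+ 2))); last first.
  by rewrite ler_wpM2l// le_max lexx orbT.
have -> : 2 * (h * q ^+ 2) = 2 * c * q + h * (q - c / h) ^+ 2 +
    h * (q - c / h) * (q + c / h) by field; rewrite gt_eqF.
by rewrite lerDl !mulr_ge0// ?(ltW h0) ?(ltW H)// addr_ge0// divr_ge0// ltW.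
Qed.

End rate.

(** As a function of [l], [opt_eta] is concave and vanishes at 0, so it lies above its chord. This
    bounds its integral below by a multiple of that of [lg], which is explicit. *)
Lemma opt_eta_concave (R : realType) (V h l l' : R) : 0 < V -> 0 < h ->
  0 <= l -> l <= l' -> 0 < l' -> opt_eta V h l' * (l / l') <= opt_eta V h l.
Proof.
move=> V0 h0 l0 ll' l'0.
have r1 : l / l' <= 1 by rewrite ler_pdivrMr// mul1r.
have r0 : 0 <= l / l' by rewrite divr_ge0// ltW.
have o0 := opt_eta_ge0 V l' h0.
rewrite [leRHS]/opt_eta le_min; apply/andP; split; last first.
  by rewrite (le_trans _ (opt_eta_le V h l'))// ler_piMr.
have o1 : opt_eta V h l' <= Num.sqrt l' / Num.sqrt V by rewrite ge_min lexx.
apply: (le_trans (ler_wpM2r r0 o1)).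
rewrite mulrAC ler_wpM2r ?invr_ge0 ?sqrtr_ge0//.
rewrite -{1}(sqr_sqrtr l0) -{2}(sqr_sqrtr (ltW l'0)).
have : 0 < Num.sqrt l' by rewrite sqrtr_gt0.
have : Num.sqrt l <= Num.sqrt l' by rewrite ler_sqrt// ltW.
move: (sqrtr_ge0 l); set q := Num.sqrt l; set q' := Num.sqrt l' => q0 qq q'0.
have -> : q' * (q ^+ 2 / q' ^+ 2) = q * (q / q') by field; rewrite gt_eqF.
by rewrite ler_piMr// ler_pdivrMr// mul1r.
Qed.

(** * The shifted logarithm *)

Section log_shift.
Context (R : realType).
Implicit Types al x s t : R.

Definition lg al x := ln (x / al + 1).

Lemma lg0 al : lg al 0 = 0.
Proof. by rewrite /lg mul0r add0r ln1. Qed.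

Let arg_gt0 al x : 0 < al -> 0 <= x -> 0 < x / al + 1.
Proof. by move=> al0 x0; rewrite ltr_wpDl// divr_ge0// ltW. Qed.

Lemma ler_lg al s t : 0 < al -> 0 <= s -> s <= t -> lg al s <= lg al t.
Proof.
move=> al0 s0 st; rewrite ler_ln ?posrE ?arg_gt0//; last exact: le_trans st.
by rewrite lerD2r ler_wpM2r// invr_ge0 ltW.
Qed.

Lemma lg_ge0 al x : 0 < al -> 0 <= x -> 0 <= lg al x.
Proof. by move=> al0 x0; rewrite -(lg0 al) ler_lg. Qed.

Lemma lg_gt0 al x : 0 < al -> 0 < x -> 0 < lg al x.
Proof. by move=> al0 x0; rewrite ln_gt0// ltrDr divr_gt0. Qed.

Lemma ler_lg_al al al' x : 0 < al' -> al' <= al -> 0 <= x ->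
  lg al x <= lg al' x.
Proof.
move=> al'0 aa x0; have al0 := lt_le_trans al'0 aa.
rewrite ler_ln ?posrE ?arg_gt0// lerD2r ler_wpM2l//.
by rewrite lef_pV2 ?posrE.
Qed.

(** This is [ln (1 + y) <= y] at [y = - (t - s) / (t + al)], where [1 + y] is the inverse ratio of
    the two arguments of [ln]. *)
Lemma lg_slope al s t : 0 < al -> 0 <= s -> s <= t ->
  (t - s) / (t + al) <= lg al t - lg al s.
Proof.
move=> al0 s0 st; have t0 := le_trans s0 st.
have sa : 0 < s + al by lra.
have ta : 0 < t + al by rewrite ltr_wpDl.
rewrite /lg -ln_div ?posrE ?arg_gt0//.
have -> : (t / al + 1) / (s / al + 1) = (1 + - ((t - s) / (t + al)))^-1.
  by field; rewrite !gt_eqF//=; lra.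
rewrite lnV ?posrE.
  rewrite lerNr le_ln1Dx// ltrN2 ltr_pdivrMr//; lra.
rewrite subr_gt0 ltr_pdivrMr//; lra.
Qed.

Lemma is_derive_lg al x : 0 < al -> 0 <= x ->
  is_derive x 1 (lg al) (x + al)^-1.
Proof.
move=> al0 x0.
have H : is_derive (x / al + 1) 1 (@ln R) (x / al + 1)^-1.
  by apply: is_derive1_ln; exact: arg_gt0.
have H2 : is_derive x 1 (fun x => x / al + 1) al^-1.
  by apply: is_derive_eq; rewrite /GRing.scale/=; field; rewrite gt_eqF.
suff -> : (x + al)^-1 = (x / al + 1)^-1 * al^-1.
  exact: (@is_derive1_comp _ (@ln R) (fun x => x / al + 1) x _ _ H H2).
by field; rewrite !gt_eqF//= ; lra.
Qed.

Lemma continuous_lg_max al :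
  0 < al -> continuous (fun x : R => lg al (Num.max x 0)).
Proof.
move=> al0 x.
have c1 : {for x, continuous (fun x : R => Num.max x 0)}.
  apply: (@continuous_max R R (fun x => x) (fun=> 0)); first exact: cvg_id.
  exact: cvg_cst.
have m0 : 0 <= Num.max x 0 by rewrite le_max lexx orbT.
apply: (@continuous_comp _ _ _ (fun x : R => Num.max x 0) (lg al)) => //.
have := is_derive_lg al0 m0 => H.
by apply: differentiable_continuous; apply/derivable1_diffP; exact: ex_derive.
Qed.

End log_shift.

(** * The regularizer as a function of the norm *)

Section regularizer.
Context (R : realType) (k al V h : R).
Hypotheses (k0 : 0 < k) (al0 : 0 < al) (V0 : 0 < V) (h0 : 0 < h).

(* [Num.max x 0] makes the density continuous on the whole line. *)
Definition density x := k * rate V h (lg al (Num.max x 0)).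

(** [psi_] is convertible to this function composed with [enorm], so later proofs pass from one to
    the other without touching the integral. *)
Definition Psi r := k * \int[lebesgue_measure]_(x in `[0, r])
  inf [set ln (x / al + 1) / eta + eta * V
      | eta in [set eta : R | 0 < eta <= 1 / h]].

Lemma densityE x : 0 <= x -> density x = k * rate V h (lg al x).
Proof. by move=> x0; rewrite /density max_l. Qed.

Lemma density0 : density 0 = 0.
Proof. by rewrite densityE// lg0 rate0// mulr0. Qed.

Lemma continuous_rate : continuous (rate V h).
Proof.
move=> l; have cs := @sqrt_continuous R l.
apply: cvgD; first by apply: cvgM => //; exact: cvg_cst.
apply: cvgM; first exact: cvg_cst.
apply: (@continuous_comp _ _ _ (fun l => Num.max (Num.sqrt l - Num.sqrt V / h) 0)
  (fun x => x ^+ 2)); last exact: exprn_continuous.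
apply: (@continuous_max R R _ (fun=> 0)); last exact: cvg_cst.
by apply: cvgB => //; exact: cvg_cst.
Qed.

Lemma continuous_density : continuous density.
Proof.
move=> x; apply: cvgM; first exact: cvg_cst.
apply: (@continuous_comp R R R (fun x => lg al (Num.max x 0)) (rate V h)).
  exact: continuous_lg_max.
exact: continuous_rate.
Qed.

(* Starting the integral at [-1], where the integrand vanishes, makes [0] an
   interior point, so that [Psi] has a two-sided derivative there. *)
Lemma PsiE r : Psi r =
  k * \int[lebesgue_measure]_(x in `[-1, r]) (rate V h (lg al (Num.max x 0))).
Proof.
congr (k * _).
transitivity (\int[lebesgue_measure]_(x in `[0, r])
                (rate V h (lg al (Num.max x 0)))).
  apply: eq_Rintegral => x; rewrite inE/= in_itv/= => /andP[x0 _].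
  by rewrite max_l// -(rate_inf V0 h0)// lg_ge0.
rewrite Rintegral_mkcond [RHS]Rintegral_mkcond; congr Rintegral.
apply/funext => x; rewrite !patchE !mem_setE !in_itv/=.
have [x0|x0] := leP 0 x; first by rewrite (le_trans _ x0)// lerN10.
rewrite lg0 rate0//=; by case: ifP.
Qed.

Lemma Psi0 : Psi 0 = 0.
Proof. by rewrite /Psi set_itv1 Rintegral_set1 mulr0. Qed.

Lemma is_derive_Psi (r : R) : 0 <= r -> is_derive r 1 Psi (density r).
Proof.
move=> r0; rewrite (_ : Psi = fun r => k * \int[lebesgue_measure]_(x in `[-1, r])
   (rate V h (lg al (Num.max x 0)))); last by apply/funext => x; exact: PsiE.
have cr : continuous (fun x : R => rate V h (lg al (Num.max x 0))).
  move=> x; apply: (@continuous_comp R R R (fun x => lg al (Num.max x 0)) (rate V h)).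
    exact: continuous_lg_max.
  exact: continuous_rate.
have [] := @continuous_FTC1_closed R (fun x => rate V h (lg al (Num.max x 0)))
  (-1) r (r + 1).
- by rewrite ltrDl.
- apply: continuous_compact_integrable; first exact: segment_compact.
  exact: continuous_subspaceT.
- by rewrite (lt_le_trans _ r0)// ltrN10.
- exact: cr.
set F := (fun r => _) => dF; rewrite derive1E => F'.
have H : is_derive r 1 F (rate V h (lg al (Num.max r 0))) by split.
have := @is_deriveZ _ _ _ F k r 1 _ H.
exact.
Qed.

(** [rate_slope] and [lg_slope] give the slope [k / ((t + al) * opt_eta)] with [opt_eta] taken at
    [t]. Both factors of the denominator grow with [t], so [M] gives a uniform bound. *)
Lemma density_slope M : 0 < M ->
  slope_ge density (k / ((M + al) * opt_eta V h (lg al M))) M.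
Proof.
move=> M0 s t s0 st tM; have t0 := le_trans s0 st.
have [->|st'] := eqVneq s t; first by rewrite !subrr mulr0.
have tgt0 : 0 < t by rewrite (le_lt_trans s0)// lt_neqAle st'.
rewrite !densityE// -mulrBr -!mulrA ler_pM2l//.
apply: le_trans (rate_slope V0 h0 (lg_ge0 al0 s0) (lg_gt0 al0 tgt0)).
have ot : 0 < opt_eta V h (lg al t) by rewrite opt_eta_gt0// lg_gt0.
have oM : opt_eta V h (lg al t) <= opt_eta V h (lg al M).
  rewrite /opt_eta le_min !ge_min lexx orbT andbT.
  rewrite ler_wpM2r ?invr_ge0 ?sqrtr_ge0//.
  by rewrite ler_wsqrtr// ler_lg.
have ta : 0 < t + al by rewrite ltr_wpDl.
apply: (@le_trans _ _ ((t - s) / (t + al) / opt_eta V h (lg al t))); last first.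
  by rewrite ler_wpM2r ?invr_ge0 ?(ltW ot)// lg_slope.
rewrite mulrC -mulrA -invfM ler_wpM2l ?subr_ge0//.
rewrite lef_pV2 ?posrE ?mulr_gt0//.
  by rewrite ler_pM ?(ltW ta) ?(ltW ot)// lerD2r.
  by rewrite addr_gt0.
by rewrite (lt_le_trans ot).
Qed.

Lemma density_incr M : slope_ge density 0 M.
Proof.
move=> s t s0 st tM; have [M0|M0] := ltP 0 M.
  have := density_slope M0 s0 st tM; apply: le_trans.
  rewrite mul0r mulr_ge0 ?subr_ge0// divr_ge0 ?(ltW k0)//.
  by rewrite mulr_ge0 ?opt_eta_ge0// addr_ge0// ltW.
have -> : s = t by apply/eqP; rewrite eq_le st/= (le_trans tM)// (le_trans M0).
by rewrite !subrr mulr0.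
Qed.

End regularizer.

(** From [expR (- (1 / 6)) >= 5 / 6] one gets [e <= (6 / 5)^6 < 3]. *)
Lemma ln3_ge1 (R : realType) : 1 <= ln (3 : R).
Proof.
rewrite -ler_expR lnK ?posrE//.
have -> : expR (1 : R) = (expR (- (1 / 6)))^-1 ^+ 6.
  by rewrite -expRN opprK -expRM_natl; congr expR; field.
have e56 : 5 / 6 <= expR (- (1 / 6)) :> R.
  by apply: le_trans (expR_ge1Dx _); lra.
apply: (@le_trans _ _ ((6 / 5) ^+ 6)); last by lra.
rewrite lerXn2r ?nnegrE ?invr_ge0 ?expR_ge0//.
by rewrite -[leRHS]invf_div lef_pV2 ?posrE ?expR_gt0.
Qed.

(** * Stability of one round *)

Section consecutive_regularizers.
Context (R : realType) (k al V h al' V' h' G : R).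
Hypotheses (k3 : 3 <= k) (al'0 : 0 < al') (al'_le : al' <= al)
  (V0 : 0 < V) (h0 : 0 < h) (h_le : h <= h')
  (G0 : 0 <= G) (GV : 4 * G <= V) (V_gain : V + G <= V').

Let k0 : 0 < k. Proof. exact: lt_le_trans k3. Qed.
Let al0 : 0 < al. Proof. exact: lt_le_trans al'_le. Qed.
Let V'0 : 0 < V'. Proof. by rewrite (lt_le_trans _ V_gain)// ltr_wpDr. Qed.
Let h'0 : 0 < h'. Proof. exact: lt_le_trans h_le. Qed.

Local Notation psi := (Psi k al V h).
Local Notation psi' := (Psi k al' V' h').

(** Primed parameters belong to the next round, and [G] is the squared gradient norm. The factor
    [k >= 3] cancels the [1 / 3] lost in [rate_gain]. *)
Lemma density_gain (x : R) : 0 <= x ->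
  density k al V h x + G * opt_eta V h (lg al x) <= density k al' V' h' x.
Proof.
move=> x0; rewrite !densityE//.
have := rate_gain V0 h0 h_le G0 GV V_gain (lg_ge0 al0 x0)
  (ler_lg_al al'0 al'_le x0).
rewrite -(ler_pM2l k0); apply: le_trans.
rewrite [leRHS]mulrDr lerD2l.
have : 0 <= G * opt_eta V h (lg al x) by rewrite mulr_ge0// opt_eta_ge0.
move: (G * _) => z z0; have := ler_wpM2r z0 k3; lra.
Qed.

Lemma Psi_gain b : 0 <= b -> psi b <= psi' b.
Proof.
move=> b0; rewrite -subr_ge0.
have -> : 0 = psi' 0 - psi 0 by rewrite !Psi0 subr0.
apply: (@le_of_derive_ge0 _ (fun x => psi' x - psi x)
  (fun x => density k al' V' h' x - density k al V h x)) => // x /andP[x0 _].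
  by apply: is_deriveB; exact: is_derive_Psi.
rewrite subr_ge0 (le_trans _ (density_gain x0))// lerDl mulr_ge0//.
exact: opt_eta_ge0.
Qed.

(* [(x + al) * lg al x - x] is an antiderivative of [lg al]. *)
Lemma Psi_gain_log M b : 3 <= lg al M -> 0 <= b <= M ->
  psi b + G * opt_eta V h (lg al M) * (2 / 3 * (M + al) - (M - b)) <= psi' b.
Proof.
move=> M3 /andP[b0 bM]; have M0 := le_trans b0 bM.
have lM : 0 < lg al M by lra.
have := opt_eta_gt0 V0 h0 lM; set o := opt_eta V h (lg al M) => o0.
pose N x := (x + al) * lg al x - x.
have dN (x : R) : 0 <= x -> is_derive x 1 N (lg al x).
  move=> x0; have := is_derive_lg al0 x0 => ?; rewrite /N.
  apply: is_derive_eq; rewrite /GRing.scale/=; field.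
  by rewrite gt_eqF// ltr_wpDl.
have lg_le x : 0 <= x <= M -> 0 <= lg al x / lg al M <= 1.
  move=> /andP[x0 xM]; rewrite ler_pdivrMr// mul1r ler_lg// andbT.
  by rewrite divr_ge0 ?(ltW lM)// lg_ge0.
(* Integrated over [[0, b]], the gain is at least [G * o / lg al M] times the integral of [lg al],
   by [opt_eta_concave]. *)
have N1 : psi' 0 - psi 0 - G * o * (N 0 / lg al M) <=
    psi' b - psi b - G * o * (N b / lg al M).
  apply: (@le_of_derive_ge0 _ (fun x => psi' x - psi x - G * o * (N x / lg al M))
    (fun x => density k al' V' h' x - density k al V h x -
              G * o * (lg al x / lg al M))) => // x /andP[x0 xb].
    have ? := dN x x0; have ? := is_derive_Psi k al'0 V'0 h'0 x0.
    have ? := is_derive_Psi k al0 V0 h0 x0.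
    apply: is_derive_eq; rewrite /GRing.scale/=; field; by rewrite gt_eqF.
  have := density_gain x0.
  have := opt_eta_concave V0 h0 (lg_ge0 al0 x0) (ler_lg al0 x0 (le_trans xb bM)) lM.
  rewrite -/o => /(ler_wpM2l G0); rewrite mulrA; lra.
(* Going from [b] to [M] adds the integral of a ratio that is at most 1, hence at most [M - b]. *)
have N2 : b - N b / lg al M <= M - N M / lg al M.
  apply: (@le_of_derive_ge0 _ (fun x => x - N x / lg al M)
    (fun x => 1 - lg al x / lg al M)) => // x /andP[bx xM].
    have ? := dN x (le_trans b0 bx).
    apply: is_derive_eq; rewrite /GRing.scale/=; field; by rewrite gt_eqF.
  have /lg_le/andP[_ ?] : 0 <= x <= M by rewrite xM (le_trans b0 bx).
  by rewrite subr_ge0.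
(* The quotient equals [M + al - M / lg al M], and [lg al M >= 3]. *)
have NM : 2 / 3 * (M + al) <= N M / lg al M.
  rewrite ler_pdivlMr// /N.
  have : 0 <= (M + al) * (lg al M - 3).
    by rewrite mulr_ge0 ?subr_ge0// addr_ge0// ltW.
  have := al0; lra.
have N0 : N 0 = 0 by rewrite /N lg0 mulr0 subr0.
move: N1; rewrite !Psi0 N0 mul0r mulr0 !subr0.
have : G * o * (2 / 3 * (M + al) - (M - b)) <= G * o * (N b / lg al M).
  by rewrite ler_wpM2l ?mulr_ge0 ?(ltW o0)//; lra.
lra.
Qed.

Context (d : nat) (g w w' : 'rV[R]_d).
Hypotheses (gG : enorm g ^+ 2 = G) (gh : enorm g <= h).

Lemma stability :
  dotp g (w - w') -
  (psi (enorm w') - psi (enorm w) -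
     dotp (rgrad (density k al V h) w) (w' - w)) -
  (psi' (enorm w') - psi (enorm w')) <= 9 / 2 * al * G / h.
Proof.
pose M := Num.max (enorm w) (enorm w').
have wM : enorm w <= M by rewrite le_max lexx.
have w'M : enorm w' <= M by rewrite le_max lexx orbT.
have MB : M - enorm w' <= enorm (w' - w).
  rewrite /M /Num.max; case: ifP => _; first by rewrite subrr enorm_ge0.
  by rewrite lerBlDl enormBC enorm_distl.
have RHS0 : 0 <= 9 / 2 * al * G / h.
  by rewrite divr_ge0 ?(ltW h0)// mulr_ge0// mulr_ge0// ltW.
(* The slope bound requires [M > 0]; otherwise both iterates are 0 and the left-hand side
   vanishes. *)
have [M0|M0] := leP M 0.
  have w0 : w = 0.
    by apply: enorm_eq0; apply/eqP; rewrite eq_le enorm_ge0 (le_trans wM).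
  have w'0 : w' = 0.
    by apply: enorm_eq0; apply/eqP; rewrite eq_le enorm_ge0 (le_trans w'M).
  by rewrite w0 w'0 subrr !(dotpC _ 0) !dotp0l enorm0 !Psi0 !subr0.
have lM := lg_gt0 al0 M0.
have := opt_eta_gt0 V0 h0 lM; set o := opt_eta V h (lg al M) => o0.
have Mal : 0 < M + al by rewrite addr_gt0.
pose K := ((M + al) * o)^-1.
have K0 : 0 < K by rewrite invr_gt0 mulr_gt0.
have gw : dotp g (w - w') <= enorm g * enorm (w' - w).
  by rewrite (enormBC w'); exact: cauchy_schwarz.
have := @radial_strong_convexity R psi (density k al V h)
  (is_derive_Psi k al0 V0 h0) (Psi0 k al V h) (density0 k al V0 h0) d (k * K) M w w'.
move=> /(_ _ _ wM w'M).
have kK : 0 <= k * K by rewrite mulr_ge0 ?ltW.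
move=> /(_ kK (density_slope k0 al0 V0 h0 M0)).
set D := _ - _ - dotp (rgrad _ _) _ => DK.
have := enorm_ge0 (w' - w); have := enorm_ge0 g.
move: gw DK MB; move: (dotp g _) D => gww D.
move: gG gh; set r := enorm (w' - w); set ga := enorm g => gaG gah gw DK MB ga0 r0.
have D3 : 3 / 2 * K * r ^+ 2 <= D.
  by apply: le_trans DK; rewrite ler_wpM2r ?sqr_ge0//; have := ler_wpM2r (ltW K0) k3; lra.
have [M3|M3] := leP 3 (lg al M).
  have := Psi_gain_log M3 (_ : 0 <= enorm w' <= M); rewrite enorm_ge0 w'M.
  move=> /(_ isT); rewrite -/o => gain.
  (* The loss [M - enorm w'] in [Psi_gain_log] costs at most one more [ga * r], because
     [ga * o <= ga / h <= 1]. *)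
  have oh : G * o * (M - enorm w') <= ga * r.
    have goh : ga * o <= 1.
      by rewrite -(divff (lt0r_neq0 h0)) ler_pM ?(ltW o0)// opt_eta_le.
    rewrite -gaG expr2 -!mulrA ler_wpM2l// mulrA.
    by rewrite -[leRHS]mul1r ler_pM ?mulr_ge0 ?(ltW o0) ?subr_ge0.
  have E : G * o * (2 / 3 * (M + al)) = 2 / 3 * ga ^+ 2 / K.
    by rewrite /K invrK gaG; ring.
  (* The two terms [ga * r], one from Cauchy-Schwarz and one from [oh], are absorbed by the
     divergence and the gain. *)
  have : 2 * ga * r <= 3 / 2 * K * r ^+ 2 + 2 / 3 * ga ^+ 2 / K.
    rewrite -subr_ge0 (_ : _ - _ = 3 / 2 * K * (r - 2 / 3 * ga / K) ^+ 2).
      by rewrite mulr_ge0 ?sqr_ge0// mulr_ge0// ltW.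
    by field; rewrite gt_eqF.
  move: gain; rewrite mulrBr; lra.
have := Psi_gain (enorm_ge0 w').
have : ga * r <= 3 / 2 * K * r ^+ 2 + ga ^+ 2 / K / 6.
  rewrite -subr_ge0 (_ : _ - _ = 3 / 2 * K * (r - ga / K / 3) ^+ 2).
    by rewrite mulr_ge0 ?sqr_ge0// mulr_ge0// ltW.
  by field; rewrite gt_eqF.
have : ga ^+ 2 / K / 6 <= 9 / 2 * al * G / h.
  (* Here [lg al M < 3 <= ln 27] since [ln 3 >= 1]. The constant [9 / 2] of the statement is
     [27 / 6]. *)
  have M27 : M + al <= 27 * al.
    have : ln (M / al + 1) <= ln 27.
      apply: le_trans (ltW M3) _; rewrite (_ : 27 = 3 ^+ 3); last by ring.
      by rewrite lnXn// -[ln _ *+ _]mulr_natl; have := ln3_ge1 R; lra.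
    rewrite ler_ln ?posrE//; last by rewrite addr_gt0// divr_gt0.
    by rewrite -(ler_pM2r al0) mulrDl mul1r divfK// gt_eqF.
  have Mo : (M + al) * o <= 27 * al * h^-1.
    by rewrite ler_pM ?(ltW o0) ?(ltW Mal)// opt_eta_le.
  rewrite /K invrK gaG; have := ler_wpM2l G0 Mo; lra.
lra.
Qed.

End consecutive_regularizers.

(** * Summing the stability terms *)

Section log_potential.
Context (R : realType) (T : nat) (c : nat -> R).
Hypothesis c01 : forall t, (1 <= t <= T)%N -> 0 <= c t <= 1.

Definition hint_sum t := 4 + \sum_(1 <= s < t) c s.
(* With [c s = |g_s|^2 / h_s^2], [hint_sum2] is convertible to [B_]. *)
Definition hint_sum2 t := 4 * \sum_(1 <= s < t.+1) hint_sum s.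

Local Notation S := hint_sum.
Local Notation B := hint_sum2.

Lemma hint_sumS t : (0 < t)%N -> S t.+1 = S t + c t.
Proof. by move=> t0; rewrite /S big_nat_recr//= addrA. Qed.

Lemma hint_sum2S t : B t.+1 = B t + 4 * S t.+1.
Proof. by rewrite /B big_nat_recr//= mulrDr. Qed.

Lemma hint_sum_ge4 t : (t <= T.+1)%N -> 4 <= S t.
Proof.
move=> tT; rewrite lerDl big_nat_cond sumr_ge0// => s.
rewrite andbT => /andP[s1 st].
have /c01/andP[] // : (1 <= s <= T)%N.
by rewrite s1/= -ltnS (leq_trans st).
Qed.

(** The induction starts with the equality [S 1 ^+ 2 = 16 = B 1]. Each step adds
    [c (2 S + c) <= 2 S + 1] on the left and [4 (S + c)] on the right. *)
Lemma sqr_hint_sum_le t : (1 <= t <= T.+1)%N -> S t ^+ 2 <= B t.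
Proof.
elim: t => // t IH /andP[_ tT].
have [->|t0] := posnP t; first by rewrite /B big_nat1 /S big_geq//; lra.
rewrite hint_sum2S; have := IH; rewrite t0 ltnW//= => /(_ isT) {}IH.
have S4 := hint_sum_ge4 (ltnW tT).
have : 0 <= c t <= 1 by apply: c01; rewrite t0.
by move=> /andP[c0 c1]; rewrite hint_sumS//; nra.
Qed.

Lemma hint_sum2_gt1 t : (1 <= t <= T.+1)%N -> 1 < B t.
Proof.
move=> tT; have /andP[_ t2] := tT.
by have := sqr_hint_sum_le tT; have := hint_sum_ge4 t2; nra.
Qed.

(** Discrete form of the fact that [- 1 / ln s] is an antiderivative of [1 / (s ln^2 s)]. The
    constant is [1 / 4 * (5 / 4)^2]: [ln b >= 2 ln s] gives [1 / 4], and the two factors [5 / 4]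
    come from [z / (s + z) >= 4 / 5 * (z / s)] and [ln (s + z) <= 5 / 4 * ln s], valid as [z <= 1],
    [s >= 4] and [ln s >= 1]. *)
Lemma log_potential_step (s z b : R) : 4 <= s -> 0 <= z <= 1 -> s ^+ 2 <= b ->
  z / (Num.sqrt b * ln b ^+ 2) <= 25 / 64 * ((ln s)^-1 - (ln (s + z))^-1).
Proof.
move=> s4 /andP[z0 z1] sb.
have s0 : 0 < s by lra.
have sz0 : 0 < s + z by lra.
have sqb : s <= Num.sqrt b.
  by rewrite -(ger0_norm (ltW s0)) -sqrtr_sqr ler_wsqrtr.
have a1 : 1 <= ln s.
  by rewrite (le_trans (ln3_ge1 R))// ler_ln ?posrE//; lra.
have lnb : 2 * ln s <= ln b.
  rewrite mulr_natl -lnXn// ler_ln ?posrE ?exprn_gt0//.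
  by rewrite (lt_le_trans _ sb)// exprn_gt0.
have ab : ln s + z / (s + z) <= ln (s + z).
  have := lg_slope s0 (lexx 0) z0.
  rewrite lg0 !subr0 /lg.
  have -> : z / s + 1 = (s + z) / s by field; rewrite gt_eqF.
  by rewrite ln_div ?posrE// [z + s]addrC; lra.
have ba : ln (s + z) <= ln s + z / s.
  have -> : s + z = s * (1 + z / s) by field; rewrite gt_eqF.
  rewrite lnM ?posrE ?lerD2l//; last by rewrite ltr_pwDl// divr_ge0// ltW.
  by rewrite le_ln1Dx// (lt_le_trans (ltrN10 _))// divr_ge0// ltW.
move: a1 lnb ab ba; set a := ln s; set b' := ln (s + z) => a1 lnb ab ba.
have a0 : 0 < a by lra.
have zs : z / s <= 4^-1 by rewrite ler_pdivrMr//; lra.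
have zs0 : 0 <= z / s by rewrite divr_ge0// ltW.
have b'0 : 0 < b' by apply: lt_le_trans ab; rewrite ltr_wpDr// divr_ge0// ltW.
have zsz : 4 / 5 * (z / s) <= z / (s + z).
  rewrite -subr_ge0 (_ : _ - _ = z * (s - 4 * z) / (5 * s * (s + z))).
    by rewrite divr_ge0 ?mulr_ge0 ?(ltW s0) ?(ltW sz0)//; lra.
  by field; rewrite !gt_eqF.
have lnb0 : 0 < ln b by lra.
have b0 : 0 < Num.sqrt b by exact: lt_le_trans sqb.
apply: (@le_trans _ _ (z / (s * (2 * a) ^+ 2))).
  rewrite ler_wpM2l// lef_pV2 ?posrE ?mulr_gt0 ?exprn_gt0 ?mulr_gt0//.
  rewrite ler_pM ?(ltW s0) ?sqr_ge0//.
  by rewrite ler_sqr ?nnegrE ?mulr_ge0 ?(ltW a0) ?(ltW lnb0).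
have -> : z / (s * (2 * a) ^+ 2) =
    25 / 64 * ((4 / 5 * (z / s)) / (a * (5 / 4 * a))).
  by field; rewrite !gt_eqF.
rewrite ler_wpM2l//.
have -> : a^-1 - b'^-1 = (b' - a) / (a * b') by field; rewrite !gt_eqF.
apply: ler_pM; first by rewrite mulr_ge0.
- by rewrite invr_ge0 !mulr_ge0 ?(ltW a0).
- by lra.
- by rewrite lef_pV2 ?posrE ?mulr_gt0// ler_wpM2l ?(ltW a0)//; lra.
Qed.

(** The bounds telescope from [hint_sum 1 = 4], and [1 / ln 4 <= 1]. *)
Lemma log_potential_sum :
  \sum_(1 <= t < T.+1) c t / (Num.sqrt (B t) * ln (B t) ^+ 2) <= 25 / 64.
Proof.
suff H n : (n <= T)%N ->
  \sum_(1 <= t < n.+1) c t / (Num.sqrt (B t) * ln (B t) ^+ 2) <=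
  25 / 64 * ((ln 4)^-1 - (ln (S n.+1))^-1).
  apply: le_trans (H T (leqnn T)) _.
  rewrite -[leRHS]mulr1 ler_wpM2l//.
  have S4 := hint_sum_ge4 (leqnn T.+1).
  have l4 : 1 <= ln (4 : R).
    by rewrite (le_trans (ln3_ge1 R))// ler_ln ?posrE//; lra.
  have : (ln (4 : R))^-1 <= 1 by rewrite invf_le1//; lra.
  have : 0 <= (ln (S T.+1))^-1 by rewrite invr_ge0 ln_ge0//; lra.
  lra.
elim: n => [|n IH] nT; first by rewrite /S !big_geq// addr0 subrr mulr0.
rewrite big_nat_recr//=.
have nT' : (n.+1 <= T.+1)%N by rewrite leqW.
have := log_potential_step (hint_sum_ge4 nT') (@c01 n.+1 _)
  (@sqr_hint_sum_le n.+1 _); rewrite /= nT' nT => /(_ isT isT).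
rewrite -hint_sumS//; have := IH (ltnW nT); lra.
Qed.

End log_potential.

(** * First-order optimality for a convex loss plus a radial regularizer *)

Section composite_step.
Context (R : realType) (F p : R -> R) (d : nat).
Hypothesis dF : forall x : R, 0 <= x -> is_derive x 1 F (p x).
Hypothesis F0 : F 0 = 0.
Hypothesis p0 : p 0 = 0.
Hypothesis cp : forall x : R, 0 <= x -> {for x, continuous p}.
Hypothesis p_incr : forall M, slope_ge p 0 M.

Lemma convex_segment (l : 'rV[R]_d -> R) (x u : 'rV[R]_d) (s : R) :
  convex_function [set: 'rV[R]_d] l -> 0 <= s <= 1 ->
  l (s *: (u - x) + x) <= l x + s * (l u - l x).
Proof.
move=> lc /andP[s0 s1].
have := lc (Itv01 s0 s1) u x; rewrite !inE => /(_ I I).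
have -> : conv (Itv01 s0 s1) (u : convex_lmodType 'rV[R]_d) x =
    s *: (u - x) + x.
  transitivity (s *: u + (1 - s) *: x) => //.
  by rewrite scalerBr scalerBl scale1r addrAC -addrA.
rewrite convRE /= /unstable.onem; lra.
Qed.

(** No gradient of [l] is involved: [x] is compared with the point at fraction [s] of the way to
    [u], and the inequality is divided by [s]. Convexity of the regularizer bounds its increment by
    the gradient at the moved point, which tends to the gradient at [x] along the segment as [s]
    decreases to 0. *)
Lemma first_order_optimality (l : 'rV[R]_d -> R) (x th : 'rV[R]_d) :
  convex_function [set: 'rV[R]_d] l ->
  (forall v, l x + F (enorm x) - dotp th x <= l v + F (enorm v) - dotp th v) ->
  forall u, l x - l u <= dotp (rgrad p x - th) (u - x).
Proof.
move=> lc xmin u.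
have := @continuous_rgrad_line R p p0 cp d p_incr x (u - x).
move=> /cvg_at_right_filter; rewrite scale0r add0r => cG.
rewrite dotpBl lerBrDr -(cvg_lim _ cG)//.
apply: limr_ge; first by apply/cvg_ex; eexists; exact: cG.
near=> s.
have s0 : 0 < s by near: s; exact: nbhs_right_gt.
have s1 : s <= 1 by near: s; exact: nbhs_right_le.
rewrite -(ler_pM2l s0).
have := xmin (s *: (u - x) + x).
have := @convex_segment l x u s lc; rewrite (ltW s0) s1 => /(_ isT).
have := radial_convexity dF F0 p0 p_incr (s *: (u - x) + x) x.
rewrite opprD addrCA subrr addr0 -scaleNr !dotpZr (dotpDr th (_ *: _)) dotpZr; lra.
Unshelve. all: by end_near. Qed.

End composite_step.

(** * Regret of centered mirror descent *)

Section regularizer_vector.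
Context (R : realType) (k al V h : R) (d : nat).
Hypotheses (k0 : 0 < k) (al0 : 0 < al) (V0 : 0 < V) (h0 : 0 < h).
Implicit Types x u : 'rV[R]_d.

(** The quadratic lower bound at [a = 0]. It makes 0 the unique minimizer of the regularizer, which
    identifies the first iterate. *)
Lemma Psi_gt0 (r : R) : 0 < r -> 0 < Psi k al V h r.
Proof.
move=> r0.
have := quadratic_lower_bound (is_derive_Psi k al0 V0 h0)
  (density_slope k0 al0 V0 h0 r0) (a := 0) (b := r).
rewrite !lexx (ltW r0) => /(_ isT isT); apply: lt_le_trans.
rewrite Psi0 density0// mul0r subr0 !add0r.
have lr := lg_gt0 al0 r0.
by rewrite !(mulr_gt0, exprn_gt0, divr_gt0, invr_gt0, addr_gt0, opt_eta_gt0).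
Qed.

Lemma gradient_Psi x :
  gradient (fun v => Psi k al V h (enorm v)) x = rgrad (density k al V h) x.
Proof.
apply: gradient_radial.
- exact: is_derive_Psi.
- exact: Psi0.
- exact: density0.
- by move=> r _; exact: continuous_density.
- by move=> M; exact: density_incr.
Qed.

Lemma Psi_convex x u :
  Psi k al V h (enorm x) + dotp (rgrad (density k al V h) x) (u - x) <=
  Psi k al V h (enorm u).
Proof.
apply: radial_convexity.
- exact: is_derive_Psi.
- exact: Psi0.
- exact: density0.
- by move=> M; exact: density_incr.
Qed.

Lemma Psi_le x : Psi k al V h (enorm x) <=
  2 * k * enorm x *
  Num.max (Num.sqrt (V * lg al (enorm x))) (h * lg al (enorm x)).
Proof.
have x0 := enorm_ge0 x.
apply: le_trans (_ : enorm x * density k al V h (enorm x) <= _).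
  apply: radial_le.
  - exact: is_derive_Psi.
  - exact: Psi0.
  - exact: density0.
  - by move=> M; exact: density_incr.
rewrite densityE//.
have -> (m : R) : 2 * k * enorm x * m = enorm x * (k * (2 * m)) by ring.
by rewrite ler_wpM2l// ler_wpM2l ?(ltW k0)// rate_le_max// lg_ge0.
Qed.

End regularizer_vector.

Section regret.
Context (R : realType) (d T : nat)
    (ell : nat -> 'rV[R]_d -> R) (g w : nat -> 'rV[R]_d)
    (h : nat -> R) (eps k : R).
Hypotheses
    (T_gt0 : (0 < T)%N)
    (ell_convex : forall t, (1 <= t <= T)%N ->
       convex_function [set: 'rV[R]_d] (ell t))
    (g_subgradient : forall t, (1 <= t <= T)%N ->
       subdifferential (ell t) (w t) (g t))
    (h1_gt0 : 0 < h 1%N)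
    (h_nondecreasing : forall t, (1 <= t < T)%N -> h t <= h t.+1)
    (h_last : h T.+1 = h T)
    (h_hint : forall t, (1 <= t <= T)%N -> enorm (g t) <= h t)
    (eps_gt0 : 0 < eps) (k_ge3 : 3 <= k)
    (w_iterates : centered_mirror_descent T ell (psi_ k eps h g)
       (fun _ _ => 0) w).

Let al := alpha_ eps h g.
Let V := V_ h g.
Let c t := enorm (g t) ^+ 2 / h t ^+ 2.
Let psi t := Psi k (al t) (V t) (h t).
Let dens t := density k (al t) (V t) (h t).
Let theta t := rgrad (dens t) (w t).

Lemma hintS t : (1 <= t <= T)%N -> h t <= h t.+1.
Proof.
move=> /andP[t1]; rewrite leq_eqVlt => /predU1P[->|tT]; first by rewrite h_last.
by apply: h_nondecreasing; rewrite t1.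
Qed.

Lemma hint_gt0 t : (1 <= t <= T.+1)%N -> 0 < h t.
Proof.
elim: t => // t IH /andP[_ tT]; have [->//|t0] := posnP t.
by apply: lt_le_trans (hintS _); rewrite ?IH// t0//= ltnW.
Qed.

Lemma hint_le_last t : (1 <= t <= T)%N -> h t <= h T.
Proof.
move=> /andP[t1 tT]; rewrite -(subnKC tT).
have : (t + (T - t) <= T)%N by rewrite subnKC.
elim: (T - t)%N => [|n IH]; first by rewrite addn0.
rewrite addnS => ntT; apply: le_trans (IH (ltnW ntT)) (hintS _).
by rewrite (ltnW ntT) andbT (leq_trans t1)// leq_addr.
Qed.

Let k0 : 0 < k. Proof. exact: lt_le_trans k_ge3. Qed.

Lemma ratio01 t : (1 <= t <= T)%N -> 0 <= c t <= 1.
Proof.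
move=> tT; have ht : 0 < h t.
  by apply: hint_gt0; case/andP: tT => -> tT; exact: leqW.
rewrite divr_ge0 ?sqr_ge0//= ler_pdivrMr ?exprn_gt0// mul1r.
by rewrite ler_sqr ?nnegrE ?enorm_ge0 ?(ltW ht)// h_hint.
Qed.

Lemma B_gt1 t : (1 <= t <= T.+1)%N -> 1 < B_ h g t.
Proof. exact: (hint_sum2_gt1 ratio01). Qed.

Lemma alpha_gt0 t : (1 <= t <= T.+1)%N -> 0 < al t.
Proof.
move=> tT; have B1 := B_gt1 tT; have B0 := lt_trans ltr01 B1.
by rewrite /al /alpha_ divr_gt0// mulr_gt0 ?sqrtr_gt0// exprn_gt0// ln_gt0.
Qed.

Lemma alpha_noninc t : (1 <= t <= T)%N -> al t.+1 <= al t.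
Proof.
move=> /andP[t1 tT].
have tT1 : (1 <= t <= T.+1)%N by rewrite t1 leqW.
have B1 := B_gt1 tT1; have B1' := @B_gt1 t.+1 tT.
have BB : B_ h g t <= B_ h g t.+1.
  rewrite [leRHS](hint_sum2S c t) lerDl mulr_ge0//.
  by rewrite (le_trans _ (hint_sum_ge4 ratio01 _)).
have B0 : 0 < B_ h g t by lra.
have B0' : 0 < B_ h g t.+1 by lra.
rewrite /al /alpha_ ler_wpM2l ?(ltW eps_gt0)//.
rewrite lef_pV2 ?posrE ?mulr_gt0 ?sqrtr_gt0 ?exprn_gt0 ?ln_gt0//.
rewrite ler_pM ?sqrtr_ge0 ?sqr_ge0 ?ler_wsqrtr//.
by rewrite ler_sqr ?nnegrE ?ler_ln ?posrE// ln_ge0// ltW.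
Qed.

Lemma V_ge t : 4 * h t ^+ 2 <= V t.
Proof. by rewrite lerDl sumr_ge0// => i _; rewrite sqr_ge0. Qed.

Lemma V_gt0 t : (1 <= t <= T.+1)%N -> 0 < V t.
Proof.
move=> tT; apply: lt_le_trans (V_ge t).
by rewrite mulr_gt0// exprn_gt0// hint_gt0.
Qed.

Lemma V_gain_round t : (1 <= t <= T)%N -> V t + enorm (g t) ^+ 2 <= V t.+1.
Proof.
move=> tT; have /andP[t1 tT'] := tT.
have ht : 0 < h t by apply: hint_gt0; rewrite t1 leqW.
rewrite /V /V_ big_nat_recr//= addrA lerD2r lerD2r ler_wpM2l//.
by rewrite ler_sqr ?nnegrE ?hintS ?(ltW ht)// (le_trans (ltW ht))// hintS.
Qed.

Lemma initial_iterate : w 1%N = 0.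
Proof.
have [w1 _] := w_iterates; have T1 : (1 <= 1 <= T.+1)%N by [].
have := w1 0; rewrite -[psi_ _ _ _ _ _ _]/(psi 1%N (enorm (w 1%N))).
rewrite -[psi_ _ _ _ _ _ 0]/(psi 1%N (enorm (0 : 'rV[R]_d))) enorm0 [leRHS]Psi0.
have [w0|w0] := eqVneq (enorm (w 1%N)) 0; first by move=> _; exact: enorm_eq0.
rewrite leNgt Psi_gt0 ?alpha_gt0 ?V_gt0// lt_neqAle enorm_ge0 andbT.
by rewrite eq_sym.
Qed.

Lemma bregman_psi t x y : (1 <= t <= T.+1)%N -> bregman (psi_ k eps h g t) x y =
  psi t (enorm x) - psi t (enorm y) - dotp (rgrad (dens t) y) (x - y).
Proof.
move=> tT; rewrite /bregman -[psi_ k eps h g t]/(fun v => psi t (enorm v)).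
by rewrite gradient_Psi// ?alpha_gt0 ?V_gt0 ?hint_gt0.
Qed.

Lemma bregman_psi_w1 t x : (1 <= t <= T.+1)%N ->
  bregman (psi_ k eps h g t) x (w 1%N) = psi t (enorm x).
Proof.
move=> tT; rewrite bregman_psi// initial_iterate enorm0 [psi t 0]Psi0.
by rewrite /rgrad scaler0 dotp0l !subr0.
Qed.

Lemma iterate_optimality t u : (1 <= t <= T)%N ->
  ell t (w t.+1) - ell t u <= dotp (theta t.+1 - theta t) (u - w t.+1).
Proof.
move=> tT; have /andP[t1 tT'] := tT.
have t1T : (1 <= t <= T.+1)%N by rewrite t1 leqW.
have t2T : (1 <= t.+1 <= T.+1)%N by [].
apply: (@first_order_optimality R (psi t.+1) (dens t.+1) d).
- by apply: is_derive_Psi; rewrite ?alpha_gt0 ?V_gt0 ?hint_gt0.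
- exact: Psi0.
- by apply: density0; rewrite ?alpha_gt0 ?V_gt0 ?hint_gt0.
- by move=> r _; apply: continuous_density; rewrite ?alpha_gt0.
- by move=> M; apply: density_incr; rewrite ?alpha_gt0 ?V_gt0 ?hint_gt0.
- exact: ell_convex.
move=> v; have [_ /(_ t tT) /(_ v)] := w_iterates.
rewrite !bregman_psi_w1// !bregman_psi// -/(theta t) !dotpBr; lra.
Qed.

(** The parenthesized term is the Fenchel conjugate of the regularizer at [theta n.+1], since
    [theta n.+1] is the gradient at [w n.+1]. Keeping it in this form lets the summation by parts
    run as an induction on [n]. *)
Lemma regret_bound u n : (n <= T)%N ->
  \sum_(1 <= t < n.+1) (ell t (w t) - ell t u) <=
  dotp (theta n.+1) u - (dotp (theta n.+1) (w n.+1) - psi n.+1 (enorm (w n.+1)))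
  + \sum_(1 <= t < n.+1) (9 / 2 * al t * enorm (g t) ^+ 2 / h t).
Proof.
elim: n => [|n IH] nT.
  rewrite !big_geq// /theta initial_iterate enorm0 [psi 1%N 0]Psi0.
  by rewrite /rgrad scaler0 !dotp0l !subr0 addr0.
rewrite !(big_nat_recr n.+1)//=.
have tT : (1 <= n.+1 <= T)%N by [].
have t1T : (1 <= n.+1 <= T.+1)%N by exact: ltnW.
have t2T : (1 <= n.+2 <= T.+1)%N by [].
have hn := hint_gt0 t1T.
have gh := h_hint tT.
have GV : 4 * enorm (g n.+1) ^+ 2 <= V n.+1.
  apply: le_trans (V_ge _); rewrite ler_wpM2l//.
  by rewrite ler_sqr ?nnegrE ?enorm_ge0 ?(ltW hn).
have := @stability R k (al n.+1) (V n.+1) (h n.+1) (al n.+2) (V n.+2) (h n.+2)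
  (enorm (g n.+1) ^+ 2) k_ge3 (alpha_gt0 t2T) (alpha_noninc tT) (V_gt0 t1T) hn
  (hintS tT) (sqr_ge0 _) GV (V_gain_round tT) d (g n.+1) (w n.+1) (w n.+2)
  erefl gh.
rewrite -/(psi _) -/(psi n.+2) -/(dens _) -/(theta _).
have := IH (ltnW nT); have := iterate_optimality u tT.
(* Optimality controls the loss at the next iterate; the subgradient inequality there carries the
   bound back to the iterate that was played. *)
have := g_subgradient tT (w n.+2).
rewrite !(dotpBl, dotpBr); lra.
Qed.

Lemma stability_sum :
  \sum_(1 <= t < T.+1) (9 / 2 * al t * enorm (g t) ^+ 2 / h t) <= 4 * eps * h T.
Proof.
have hT : 0 < h T by apply: hint_gt0; rewrite T_gt0 leqW.
apply: (@le_trans _ _ (\sum_(1 <= t < T.+1) 9 / 2 * eps * h T *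
   (c t / (Num.sqrt (B_ h g t) * ln (B_ h g t) ^+ 2)))).
  apply: ler_sum_nat => t tT; have t1T : (1 <= t <= T.+1)%N.
    by case/andP: tT => -> /ltnW.
  have ht := hint_gt0 t1T; have B1 := B_gt1 t1T.
  have B0 : 0 < B_ h g t by lra.
  have D0 : 0 < Num.sqrt (B_ h g t) * ln (B_ h g t) ^+ 2.
    by rewrite mulr_gt0 ?sqrtr_gt0// exprn_gt0// ln_gt0.
  have c0 : 0 <= c t by have /andP[] := ratio01 tT.
  have -> : 9 / 2 * al t * enorm (g t) ^+ 2 / h t = 9 / 2 * eps * h t *
    (c t / (Num.sqrt (B_ h g t) * ln (B_ h g t) ^+ 2)).
    rewrite /al /alpha_ /c; move: D0; set D := Num.sqrt _ * _ => D0.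
    by field; rewrite !gt_eqF.
  apply: ler_wpM2r; first by rewrite divr_ge0// ltW.
  apply: ler_wpM2l; first by rewrite mulr_ge0// ltW.
  exact: hint_le_last.
rewrite -mulr_sumr.
(* The constants leave room: [9 / 2 * (25 / 64) < 4]. *)
have : 0 < eps * h T by rewrite mulr_gt0.
have := log_potential_sum ratio01.
rewrite -/(B_ h g); move: (\sum_(_ <= _ < _) _) => s; nra.
Qed.

End regret.

Theorem theorem6 (R : realType) (d T : nat)
    (ell : nat -> 'rV[R]_d -> R) (g w : nat -> 'rV[R]_d)
    (h : nat -> R) (eps k : R)
    (T_gt0 : (0 < T)%N)
    (ell_convex : forall t, (1 <= t <= T)%N ->
       convex_function [set: 'rV[R]_d] (ell t))
    (g_subgradient : forall t, (1 <= t <= T)%N ->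
       subdifferential (ell t) (w t) (g t))
    (h1_gt0 : 0 < h 1%N)
    (h_nondecreasing : forall t, (1 <= t < T)%N -> h t <= h t.+1)
    (h_last : h T.+1 = h T)
    (h_hint : forall t, (1 <= t <= T)%N -> enorm (g t) <= h t)
    (eps_gt0 : 0 < eps) (k_ge3 : 3 <= k)
    (w_iterates : centered_mirror_descent T ell (psi_ k eps h g)
       (fun _ _ => 0) w)
    (u : 'rV[R]_d) :
  let lambda :=
    ln (enorm u * Num.sqrt (B_ h g T.+1) * ln (B_ h g T.+1) ^+ 2 / eps + 1) in
  \sum_(1 <= t < T.+1) (ell t (w t) - ell t u) <=
    4 * eps * h T +
    2 * k * enorm u *
      Num.max (Num.sqrt (V_ h g T.+1 * lambda)) (h T * lambda).
Proof.
cbv zeta; set lambda := ln _.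
have TT : (1 <= T.+1 <= T.+1)%N by exact: leqnn.
have al0 := alpha_gt0 h1_gt0 h_nondecreasing h_last h_hint eps_gt0 TT.
have V0 := V_gt0 g h1_gt0 h_nondecreasing h_last TT.
have h0 := hint_gt0 h1_gt0 h_nondecreasing h_last TT.
have k0 : 0 < k by exact: lt_le_trans k_ge3.
have := regret_bound ell_convex g_subgradient h1_gt0 h_nondecreasing h_last
  h_hint eps_gt0 k_ge3 w_iterates u (leqnn T).
have := stability_sum T_gt0 h1_gt0 h_nondecreasing h_last h_hint eps_gt0.
(* Fenchel-Young inequality: [<theta, u>] minus the conjugate at [theta] is at most the last
   regularizer at [u]. *)
have := Psi_convex k0 al0 V0 h0 (w T.+1) u.
have := Psi_le k0 al0 V0 h0 u.
have -> : lg (alpha_ eps h g T.+1) (enorm u) = lambda.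
  by rewrite /lg /alpha_ invf_div mulrA mulrA.
rewrite h_last dotpBr; lra.
Qed.
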